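(* Let $X$ be a Banach space and let $C\subset X$ be a nonempty weakly compact convex set having the weak Banach–Saks property. Then every $\mathfrak{cm}$-nonexpansive map $T\colon C\to C$ has a fixed point.
   Context: A subset $K$ of a Banach space has the weak Banach–Saks property if whenever $(x_n)\subset K$ converges weakly to $x$, there is a subsequence $(y_i)$ of $(x_n)$ such that $\frac1n\sum_{i=1}^n y_i\to x$ in norm. For a bounded convex set $C$, a nonexpansive map $T\colon C\to C$ (i.e. $\|Tx-Ty\|\le\|x-y\|$) is $\mathfrak{cm}$-nonexpansive if for all $n\in\mathbb{N}$, $y\in C$ and sequences $(u_i)_{i=1}^\infty\subset C$: $\limsup_{i\to\infty}\sup_{A\subset\{1,\dots,n\}}\|\sum_{k\in A}(Tu_{i+k}-Ty)\|\le\limsup_{i\to\infty}\sup_{A\subset\{1,\dots,n\}}\|\sum_{k\in A}(u_{i+k}-y)\|$. *)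

(* Defs.v *)
From HB Require Import structures.
From mathcomp Require Import all_boot all_order all_algebra.
From mathcomp Require Import all_classical all_reals all_analysis.
Set Implicit Arguments. Unset Strict Implicit. Unset Printing Implicit Defensive.
Import Order.TTheory GRing.Theory Num.Theory.
Import numFieldNormedType.Exports.
Local Open Scope classical_set_scope.
Local Open Scope ring_scope.

Section Defs.
Context {R : realType} {X : normedModType R}.

Definition dual_functional (f : X -> R) : Prop :=
  (forall (a : R) (x y : X), f (a *: x + y) = a * f x + f y) /\ continuous f.

Definition weakly_open (U : set X) : Prop :=
  forall x, U x -> exists (fs : seq (X -> R)) (e : R),
    [/\ 0 < e, (forall f, f \in fs -> dual_functional f) &
        [set y | forall f, f \in fs -> `|f y - f x| < e] `<=` U].

Definition weakly_compact (C : set X) : Prop :=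
  forall (I : Type) (U : I -> set X),
    (forall i, weakly_open (U i)) -> C `<=` \bigcup_i U i ->
    exists (n : nat) (g : nat -> I),
      forall x, C x -> exists2 k, (k < n)%N & U (g k) x.

Definition convex_set_X (C : set X) : Prop :=
  forall x y (t : R), C x -> C y -> 0 <= t -> t <= 1 -> C (t *: x + (1 - t) *: y).

Definition weakly_cvg (u : nat -> X) (x : X) : Prop :=
  forall f, dual_functional f -> (fun n => f (u n)) @ \oo --> f x.

Definition weak_banach_saks (K : set X) : Prop :=
  forall (u : nat -> X) (x : X), (forall n, K (u n)) -> weakly_cvg u x ->
    exists phi : nat -> nat, {homo phi : m n / (m < n)%N >-> (m < n)%N} /\
      (fun n => n.+1%:R^-1 *: \sum_(i < n.+1) u (phi i)) @ \oo --> x.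

Definition nonexpansive_on (C : set X) (T : X -> X) : Prop :=
  forall x y, C x -> C y -> `|T x - T y| <= `|x - y|.

(* sup_{A subset {1..n}} || sum_{k in A} (v (i+k) - w) ||  (k : 'I_n encodes k+1) *)
Definition cm_sup (n : nat) (v : nat -> X) (w : X) (i : nat) : R :=
  \big[Num.max/0]_(A : {set 'I_n}) `|\sum_(k in A) (v (i + k.+1)%N - w)|.

Definition cm_nonexpansive (C : set X) (T : X -> X) : Prop :=
  [/\ (forall x, C x -> C (T x)), nonexpansive_on C T &
    forall (n : nat) (y : X) (u : nat -> X), C y -> (forall i, C (u i)) ->
      (limn_esup (fun i => (cm_sup n (T \o u) (T y) i)%:E)
        <= limn_esup (fun i => (cm_sup n u y i)%:E))%E ].

End Defs.

(* Main.v *)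
(* Iterating the contractions t x0 + (1 - t) T gives approximate fixed points u_k in C,
   which by Eberlein-Smulian may be taken to converge weakly to some x in C.  By
   Ramsey's theorem, for each e > 0 one may also pass to a subsequence along which, for
   a single length m, either all or none of the m-term sums of u_k - x have norm at most
   e m.  If "none" occurred for every m, a diagonal sequence would contradict the weak
   Banach-Saks property, because the blocks S_2m - S_m of a Cesaro summable sequence are
   o(m).  In the other case, cutting any sum over a subset of n consecutive indices into
   blocks of length m bounds it by e n + O(1).  As T u_k - u_k -> 0, the
   cm-condition at y = x bounds in the same way the sums of u_k - T x; since
   n (x - T x) is a difference of two such sums, |x - T x| <= 2 e. *)
Require Import Defs.
From HB Require Import structures.
From mathcomp Require Import all_boot all_order all_algebra.
From mathcomp Require Import all_classical all_reals all_analysis.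
From mathcomp Require Import ring lra.
Import Order.TTheory GRing.Theory Num.Theory.
Import numFieldNormedType.Exports.
Local Open Scope classical_set_scope.
Local Open Scope ring_scope.

(** * Hahn-Banach by way of minimal sublinear functionals *)

Section HahnBanach.
Context {R : realType} {V : lmodType R}.
Implicit Types (p q : V -> R) (x y z : V) (s t : R).

Definition sublinear q :=
  (forall x y, q (x + y) <= q x + q y) /\
  (forall t x, 0 <= t -> q (t *: x) = t * q x).

(** The reverse homogeneity inequality is the given one for [t^-1] at [t *: x]. This form suits
    functionals defined as infima, where upper bounds are the easy direction. *)
Lemma sublinearI q : (forall x y, q (x + y) <= q x + q y) -> q 0 <= 0 ->
  (forall t x, 0 < t -> q (t *: x) <= t * q x) -> sublinear q.
Proof.
move=> qD q0 qZ; split=> // t x; rewrite le_eqVlt => /predU1P[<-|t0].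
  rewrite scale0r mul0r; apply/eqP; rewrite eq_le q0 /=.
  by have := qD 0 0; rewrite addr0; lra.
apply/eqP; rewrite eq_le qZ //=.
have := qZ t^-1 (t *: x); rewrite invr_gt0 scalerA mulVf ?gt_eqF// scale1r.
by move=> /(_ t0); rewrite ler_pdivlMl.
Qed.

Lemma sublinear0 {q} : sublinear q -> q 0 = 0.
Proof. by case=> _ qZ; rewrite -(scale0r 0) qZ// mul0r. Qed.

Lemma sublinearN_le {q} : sublinear q -> forall x, - q (- x) <= q x.
Proof.
move=> sq x; have [qD _] := sq; have := qD x (- x).
by rewrite subrr (sublinear0 sq); lra.
Qed.

Lemma le_infD (A B : set R) (c : R) : A !=set0 -> B !=set0 ->
  (forall a b, A a -> B b -> c <= a + b) -> c <= inf A + inf B.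
Proof.
move=> A0 B0 cAB; rewrite -lerBlDr; apply: lb_le_inf => // a Aa.
rewrite lerBlDr addrC -lerBlDr; apply: lb_le_inf => // b Bb.
by rewrite lerBlDr addrC; exact: cAB.
Qed.

(* A sublinear functional q is minimal only if tilt q y = q for all y, and the term
   t = 1 then reads q x + q y <= q (x + y): minimal sublinear functionals are additive. *)
Definition tilt q y x : R :=
  inf [set q (x + t *: y) - t * q y | t in [set t | 0 <= t]].

Lemma tilt_le q y x t : sublinear q -> 0 <= t -> tilt q y x <= q (x + t *: y) - t * q y.
Proof.
move=> sq t0; have [qD qZ] := sq; apply: ge_inf; last by exists t.
exists (- q (- x)) => _ /= [s s0 <-].
have := qD (x + s *: y) (- x); rewrite addrAC subrr add0r qZ//; lra.
Qed.

Lemma sublinear_tilt q y : sublinear q -> sublinear (tilt q y).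
Proof.
move=> sq; have [qD qZ] := sq.
have ne x : [set q (x + t *: y) - t * q y | t in [set t | 0 <= t]] !=set0.
  by exists (q (x + 0 *: y) - 0 * q y); exists 0 => /=.
apply: sublinearI => [x z||s x s0].
- apply: le_infD => // _ _ [s /= s0 <-] [t /= t0 <-].
  have /le_trans -> // := @tilt_le q y (x + z) (s + t) sq (addr_ge0 s0 t0).
  by have := qD (x + s *: y) (z + t *: y); rewrite scalerDl addrACA; lra.
- have /le_trans -> // := @tilt_le q y 0 0 sq (lexx 0).
  by rewrite scale0r addr0 (sublinear0 sq) mul0r subrr.
- rewrite -ler_pdivrMl//; apply: lb_le_inf => // _ [t /= t0 <-].
  rewrite ler_pdivrMl//.
  have /le_trans -> // := @tilt_le q y (s *: x) (s * t) sq (mulr_ge0 (ltW s0) t0).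
  by rewrite -scalerA -scalerDr qZ ?(ltW s0)//; lra.
Qed.

Lemma tilt_id q y x : sublinear q -> tilt q y x <= q x.
Proof.
by move=> sq; have := @tilt_le q y x 0 sq (lexx 0); rewrite scale0r addr0 mul0r subr0.
Qed.

Lemma minimal_sublinear_linear q : sublinear q ->
  (forall r, sublinear r -> (forall x, r x <= q x) -> forall x, q x <= r x) ->
  forall a x y, q (a *: x + y) = a * q x + q y.
Proof.
move=> sq qmin; have [qD qZ] := sq.
have qadd x y : q (x + y) = q x + q y.
  apply/eqP; rewrite eq_le qD/= -lerBrDr.
  have /le_trans -> // := qmin _ (sublinear_tilt _ y sq) (fun z => @tilt_id q y z sq) x.
  by have := @tilt_le q y x 1 sq ler01; rewrite scale1r mul1r.
have qN x : q (- x) = - q x.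
  by apply/eqP; rewrite -addr_eq0 -qadd addNr (sublinear0 sq).
move=> a x y; rewrite qadd; congr (_ + _).
have [a0|/ltW a0] := leP 0 a; first exact: qZ.
by rewrite -[a in LHS]opprK scaleNr qN qZ ?oppr_ge0// mulNr opprK.
Qed.

(** Zorn's lemma for the reversed pointwise order. A chain is bounded by its pointwise infimum,
    which exists because [- p (- x)] lies below every member; it is subadditive because the smaller
    of two members can be used at both points. *)
Lemma ex_minimal_sublinear p : sublinear p -> exists q,
  [/\ sublinear q, forall x, q x <= p x &
   forall r, sublinear r -> (forall x, r x <= q x) -> forall x, q x <= r x].
Proof.
move=> sp; pose T := {q | sublinear q /\ forall x, q x <= p x}.
pose ge (q r : T) : bool := `[< forall x, sval r x <= sval q x >].
have [|||[q [sq qp]] qmin] :=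
  @ZL_preorder T (exist _ p (conj sp (fun x => lexx (p x)))) ge.
- by move=> q; apply/asboolP => x.
- move=> r q s /asboolP qr /asboolP rs; apply/asboolP => x.
  exact: le_trans (rs x) (qr x).
- move=> A totA.
  have [->|/set0P[q0 Aq0]] := eqVneq A set0.
    by exists (exist _ p (conj sp (fun x => lexx (p x)))) => q [].
  pose m x := inf [set sval q x | q in A].
  have m_le (q : T) x : A q -> m x <= sval q x.
    move=> Aq; apply: ge_inf; last by exists q.
    exists (- p (- x)) => _ [[r [sr rp]] Ar <-] /=.
    by have := sublinearN_le sr x; have := rp (- x); lra.
  have ne x : [set sval q x | q in A] !=set0 by exists (sval q0 x); exists q0.
  have sm : sublinear m.
    apply: sublinearI => [x y||t x t0].
    + apply: le_infD => // _ _ [q Aq <-] [r Ar <-].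
      have := (svalP q).1.1 x y; have := (svalP r).1.1 x y.
      have := m_le _ (x + y) Aq; have := m_le _ (x + y) Ar.
      by have [/asboolP/(_ x)|/asboolP/(_ y)] := totA _ _ Aq Ar; lra.
    + by have /le_trans -> // := m_le _ 0 Aq0; rewrite (sublinear0 (svalP q0).1).
    + rewrite -ler_pdivrMl//; apply: lb_le_inf => // _ [q Aq <-].
      by rewrite ler_pdivrMl//; rewrite -((svalP q).1.2 _ _ (ltW t0)); exact: m_le.
  have mp x : m x <= p x by exact: le_trans (m_le _ x Aq0) ((svalP q0).2 x).
  by exists (exist _ m (conj sm mp)) => q Aq; apply/asboolP => x; exact: m_le.
- exists q; split=> // r sr rq.
  have rp x : r x <= p x by exact: le_trans (rq x) (qp x).
  by have /(_ _)/asboolP := qmin (exist _ r (conj sr rp)); apply; exact/asboolP.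
Qed.

Lemma hahn_banach_sublinear p z : sublinear p -> exists f : V -> R,
  [/\ forall a x y, f (a *: x + y) = a * f x + f y,
      forall x, f x <= p x & f z = p z].
Proof.
move=> sp; (* Starting the descent at tilt p z forces the minimal functional to equal p at z. *)
have [q [sq qt qmin]] := ex_minimal_sublinear _ (sublinear_tilt _ z sp).
have qlin := minimal_sublinear_linear _ sq qmin.
have qp x : q x <= p x by exact: le_trans (qt x) (tilt_id _ _ _ sp).
exists q; split=> //; apply/eqP; rewrite eq_le qp/=.
have := tilt_le _ z (- z) _ sp ler01.
rewrite scale1r addNr (sublinear0 sp) => tz.
have := qt (- z); have := qlin (-1) z 0; rewrite (sublinear0 sq) addr0 scaleN1r; lra.
Qed.

End HahnBanach.

(** * Norming and separating continuous functionals *)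

Section DualFunctionals.
Context {R : realType} {X : normedModType R}.
Implicit Types (f : X -> R) (x y z : X) (Y : set X).

Lemma dual0 f : dual_functional f -> f 0 = 0.
Proof. by case=> /(_ 1 0 0) + _; rewrite scaler0 addr0; lra. Qed.

Lemma dualZ f : dual_functional f -> forall a x, f (a *: x) = a * f x.
Proof. by move=> df a x; have := df.1 a x 0; rewrite (dual0 _ df) !addr0. Qed.

Lemma dualB f : dual_functional f -> forall x y, f (x - y) = f x - f y.
Proof. by move=> df x y; have := df.1 (-1) y x; rewrite scaleN1r addrC; lra. Qed.

Lemma dualN f : dual_functional f -> forall x, f (- x) = - f x.
Proof. by move=> df x; rewrite -scaleN1r dualZ// mulN1r. Qed.

Lemma linear_bounded_dual f (K : R) :
  (forall a x y, f (a *: x + y) = a * f x + f y) ->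
  (forall x, f x <= K * `|x|) -> dual_functional f.
Proof.
move=> flin fK; split=> // x.
have fB y z : f (y - z) = f y - f z by have := flin (-1) z y; rewrite scaleN1r addrC; lra.
(* The bound at [- y] makes the estimate two-sided; [|K| + 1] is positive, so it can be divided by
   later. *)
have fabs y : `|f y| <= (`|K| + 1) * `|y|.
  have f0 : f 0 = 0 by have := fB 0 0; rewrite subr0; lra.
  have fN : f (- y) = - f y by rewrite -[- y]sub0r fB f0 sub0r.
  have := fK y; have := fK (- y); rewrite fN normrN.
  have := ler_wpM2r (normr_ge0 y) (ler_norm K).
  by have := normr_ge0 y; rewrite ler_norml => *; apply/andP; split; lra.
apply/cvgrPdist_lt => e e0; near=> y.
rewrite -fB; apply: le_lt_trans (fabs _) _.
rewrite -ltr_pdivlMl; last by rewrite ltr_wpDl.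
near: y; apply: cvgr_dist_lt => //.
by rewrite mulr_gt0// invr_gt0 ltr_wpDl.
Unshelve. all: by end_near. Qed.

Lemma sublinear_norm : sublinear (fun x : X => `|x|).
Proof.
split=> [x y|t x t0]; first exact: ler_normD.
by rewrite normrZ ger0_norm.
Qed.

Lemma norming_functional x : exists f,
  [/\ dual_functional f, forall y, f y <= `|y| & f x = `|x|].
Proof.
have [f [flin fle fx]] := hahn_banach_sublinear _ x sublinear_norm.
exists f; split=> //; apply: (linear_bounded_dual _ 1) => // y.
by rewrite mul1r.
Qed.

Lemma dual_le_normr f : dual_functional f -> (forall y, f y <= `|y|) ->
  forall y, `|f y| <= `|y|.
Proof.
move=> df fle y; rewrite ler_norml fle andbT.
by have := fle (- y); rewrite normrN dualN//; lra.
Qed.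

(** Hahn-Banach for the distance [p] to the subspace [Y]: a linear [f <= p] is nonpositive on [Y],
    hence zero there as [Y] is symmetric, and [f z = p z >= e]. *)
Lemma separating_functional Y z (e : R) : Y 0 ->
  (forall a x y, Y x -> Y y -> Y (a *: x + y)) ->
  0 < e -> (forall y, Y y -> e <= `|z - y|) ->
  exists f, [/\ dual_functional f, forall y, Y y -> f y = 0 & f z != 0].
Proof.
move=> Y0 YL e0 zY; pose p x : R := inf [set `|x - y| | y in Y].
have p_le x y : Y y -> p x <= `|x - y|.
  by move=> Yy; apply: ge_inf; [exists 0 => _ [w _ <-] | exists y].
have ne x : [set `|x - y| | y in Y] !=set0 by exists `|x - 0|; exists 0.
have sp : sublinear p.
  apply: sublinearI => [x y||t x t0].
  - apply: le_infD => // _ _ [v Yv <-] [w Yw <-].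
    have Yvw : Y (v + w) by rewrite -[v]scale1r; exact: YL.
    by rewrite (le_trans (p_le _ _ Yvw))// opprD addrACA ler_normD.
  - by rewrite (le_trans (p_le _ _ Y0))// subr0 normr0.
  - rewrite -ler_pdivrMl//; apply: lb_le_inf => // _ [y Yy <-].
    have Yty : Y (t *: y) by rewrite -[_ *: _]addr0; exact: YL.
    rewrite ler_pdivrMl// (le_trans (p_le _ _ Yty))// -scalerBr normrZ.
    by rewrite ger0_norm ?(ltW t0).
have [f [flin fle fz]] := hahn_banach_sublinear _ z sp.
have df : dual_functional f.
  apply: (linear_bounded_dual _ 1) => // y.
  by rewrite (le_trans (fle y))// mul1r (le_trans (p_le _ _ Y0))// subr0.
exists f; split=> //.
  have f_le0 y : Y y -> f y <= 0.
    by move=> Yy; rewrite (le_trans (fle y))// (le_trans (p_le _ _ Yy))// subrr normr0.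
  move=> y Yy; apply/eqP; rewrite eq_le f_le0//=.
  have /f_le0 : Y (-1 *: y + 0) by exact: YL.
  by rewrite addr0 scaleN1r dualN//; lra.
rewrite fz gt_eqF// (lt_le_trans e0)//; apply: lb_le_inf => // _ [y Yy <-].
exact: zY.
Qed.

End DualFunctionals.

(** * Increasing sequences of indices *)

Lemma increasing_selection (P : nat -> nat -> Prop) :
  (forall k N, exists2 n, (N <= n)%N & P k n) ->
  exists2 phi : nat -> nat, {homo phi : m n / (m < n)%N} & forall k, P k (phi k).
Proof.
move=> H; have /choice[g gP] : forall a : nat * nat, exists n, (a.2 <= n)%N /\ P a.1 n.
  by move=> [k N]; have [n] := H k N; exists n.
pose phi := fix phi k := if k is k'.+1 then g (k, (phi k').+1) else g (0, 0)%N.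
exists phi; last by case=> [|k]; exact: (gP (_, _)).2.
by apply: homo_ltn => [? ? ?|k]; [exact: ltn_trans | exact: (gP (k.+1, _)).1].
Qed.

Lemma increasing_ge_id (phi : nat -> nat) : {homo phi : m n / (m < n)%N} ->
  forall n, (n <= phi n)%N.
Proof. by move=> phiI; elim=> // n IH; exact: leq_ltn_trans IH (phiI _ _ (ltnSn n)). Qed.

(** * Weak cluster points in weakly compact sets *)

Section WeakCompactness.
Context {R : realType} {X : normedModType R}.
Implicit Types (f : X -> R) (x y z : X) (C : set X) (u : nat -> X).

(** Finitely many functionals and one radius describe a basic weak neighbourhood, so this is a
    cluster point in the weak topology. *)
Definition weak_cluster u x := forall (fs : seq (X -> R)) (e : R) (N : nat), 0 < e ->
  (forall f, f \in fs -> dual_functional f) ->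
  exists2 n, (N <= n)%N & forall f, f \in fs -> `|f (u n) - f x| < e.

Lemma weakly_open_ball x (fs : seq (X -> R)) (e : R) :
  (forall f, f \in fs -> dual_functional f) ->
  weakly_open [set y | forall f, f \in fs -> `|f y - f x| < e].
Proof.
move=> dfs y /= ye.
have [d d0 dle] : exists2 d : R, 0 < d & forall f, f \in fs -> d <= e - `|f y - f x|.
  elim: fs {dfs} ye => [|g fs IH] ye; first by exists 1.
  have [|d d0 dle] := IH; first by move=> f ffs; apply: ye; rewrite inE ffs orbT.
  have := ye g; rewrite mem_head => /(_ isT) yg.
  exists (Num.min d (e - `|g y - g x|)); first by rewrite lt_min d0 subr_gt0.
  by move=> f; rewrite inE ge_min => /predU1P[->|/dle ->//]; rewrite lexx orbT.
exists fs, d; split=> // w /= wd f ffs.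
have := wd f ffs; have := dle f ffs; have := ler_distD (f y) (f w) (f x); lra.
Qed.

(** Otherwise the weakly open sets that [u] avoids from some index on cover [C]. Past the largest
    index of a finite subcover, [u] would lie in none of its members. *)
Lemma weakly_compact_cluster C u : weakly_compact C -> (forall n, C (u n)) ->
  exists2 x, C x & weak_cluster u x.
Proof.
move=> wC Cu; apply: contrapT => nocluster.
pose I := {W : set X * nat | weakly_open W.1 /\ forall n, (W.2 <= n)%N -> ~ W.1 (u n)}.
have [|x Cx|n [g gC]] := wC I (fun W => (sval W).1).
- by move=> W; exact: (svalP W).1.
- have : ~ weak_cluster u x by move=> xu; apply: nocluster; exists x.
  move=> /existsNP[fs /existsNP[e /existsNP[N /not_implyP[e0 /not_implyP[dfs NN]]]]].
  have WW : weakly_open [set y | forall f, f \in fs -> `|f y - f x| < e] /\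
      forall n, (N <= n)%N -> ~ [set y | forall f, f \in fs -> `|f y - f x| < e] (u n).
    by split; [exact: weakly_open_ball | move=> n Nn un; apply: NN; exists n].
  by exists (exist _ (_, N) WW) => //= f _; rewrite subrr normr0.
pose m := (\max_(k < n) (sval (g k)).2)%N.
have [k kn] := gC _ (Cu m).
apply: (svalP (g k)).2; exact: (leq_bigmax (Ordinal kn)).
Qed.

(** If [|f (u n)| > n], a weak cluster point [x] of [u] would give arbitrarily large [n] with
    [|f (u n)| < |f x| + 1]. *)
Lemma dual_bounded_on C f : weakly_compact C -> dual_functional f ->
  exists B : R, forall x, C x -> `|f x| <= B.
Proof.
move=> wC df; apply: contrapT => nB.
have /choice[u uP] : forall n : nat, exists x, C x /\ n%:R < `|f x|.
  move=> n; apply: contrapT => nx; apply: nB; exists n%:R => x Cx.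
  by rewrite leNgt; apply/negP => xn; apply: nx; exists x.
have [x Cx xu] := weakly_compact_cluster _ _ wC (fun n => (uP n).1).
have [|n] := xu [:: f] 1 (Num.truncn (`|f x| + 1)).+1 ltr01.
  by move=> g; rewrite inE => /eqP ->.
move=> nle /(_ f (mem_head _ _)) fn.
have : `|f x| + 1 < n%:R by rewrite (lt_le_trans (truncnS_gt _))// ler_nat.
by have := (uP n).2; have := lerB_dist (f (u n)) (f x); lra.
Qed.

End WeakCompactness.

(** * The Eberlein-Smulian theorem: weakly convergent subsequences *)

Section EberleinSmulian.
Context {R : realType} {X : normedModType R}.
Implicit Types (f : X -> R) (x y z : X) (C : set X) (u : nat -> X).

(** Rational coefficients make the lists [s] a countable type, so that all combinations can be
    enumerated. *)
Definition rat_comb u (s : seq (rat * nat)) : X := \sum_(a <- s) ratr a.1 *: u a.2.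

Definition rat_span_closure u : set X :=
  [set x | forall e : R, 0 < e -> exists s, `|x - rat_comb u s| < e].

Lemma rat_comb_mem u n : rat_span_closure u (u n).
Proof.
by move=> e e0; exists [:: (1, n)]; rewrite /rat_comb big_seq1 rmorph1 scale1r subrr normr0.
Qed.

Lemma rat_span_closure0 u : rat_span_closure u 0.
Proof. by move=> e e0; exists [::]; rewrite /rat_comb big_nil subrr normr0. Qed.

Lemma rat_span_closure_lin u a x y : rat_span_closure u x -> rat_span_closure u y ->
  rat_span_closure u (a *: x + y).
Proof.
move=> Yx Yy e e0.
have a1 : 0 < `|a| + 1 by rewrite ltr_wpDl.
have [s xs] := Yx (e / 3 / (`|a| + 1)) ltac:(by rewrite !divr_gt0).
have [t yt] := Yy (e / 3) ltac:(by rewrite divr_gt0).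
set v := rat_comb u s in xs; set w := rat_comb u t in yt.
have v1 : 0 < `|v| + 1 by rewrite ltr_wpDl.
have d0 : 0 < e / 3 / (`|v| + 1) by rewrite !divr_gt0.
(* The coefficient [a] is replaced by a rational [r] so close that the error on [v] is at most
   [e / 3]; the errors from [x - v] and [y - w] take the other two thirds. *)
have [|r] := @rat_in_itvoo R a (a + e / 3 / (`|v| + 1)); first by rewrite ltrDl.
rewrite in_itv/= => /andP[ar rd].
exists ([seq (r * c.1, c.2) | c <- s] ++ t).
rewrite /rat_comb big_cat big_map/= -/(rat_comb u t) -/w.
under eq_bigr do rewrite rmorphM -scalerA.
rewrite -scaler_sumr -/(rat_comb u s) -/v.
have -> : a *: x + y - (ratr r *: v + w) = a *: (x - v) + ((a - ratr r) *: v + (y - w)).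
  by rewrite scalerBr scalerBl opprD addrACA !addrA subrK.
have h1 : `|a *: (x - v)| <= e / 3.
  rewrite normrZ; move: xs; rewrite ltr_pdivlMr// => /ltW; apply: le_trans.
  by rewrite mulrC ler_wpM2l// lerDl.
have h2 : `|(a - ratr r) *: v| <= e / 3.
  rewrite normrZ distrC gtr0_norm ?subr_gt0//.
  have : ratr r - a < e / 3 / (`|v| + 1) by lra.
  rewrite ltr_pdivlMr// => /ltW; apply: le_trans.
  by rewrite ler_wpM2l ?lerDl// subr_ge0 ltW.
have := ler_normD (a *: (x - v)) ((a - ratr r) *: v + (y - w)).
have := ler_normD ((a - ratr r) *: v) (y - w); lra.
Qed.

(** A closed subspace is weakly closed: a functional that vanishes on the closed span but not at [x]
    keeps every [u n] at distance [|f x|] from [x]. *)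
Lemma weak_cluster_rat_span_closure u (phi : nat -> nat) x :
  weak_cluster (u \o phi) x -> rat_span_closure u x.
Proof.
move=> xu; apply: contrapT => /existsNP[e /not_implyP[e0 /forallNP es]].
have [|||y Yy|f [df fY fx]] := separating_functional (rat_span_closure u) x e.
- exact: rat_span_closure0.
- by move=> a y z; exact: rat_span_closure_lin.
- exact: e0.
- apply/ler_addgt0Pr => d d0; have [s ys] := Yy _ d0.
  have /negP := es s; rewrite -leNgt; have := ler_distD y x (rat_comb u s); lra.
have [||n _] := xu [:: f] `|f x| 0%N; first by rewrite normr_gt0.
  by move=> g; rewrite inE => /eqP ->.
move=> /(_ f (mem_head _ _)) /=.
by rewrite fY; [rewrite sub0r normrN ltxx | exact: rat_comb_mem].
Qed.

Lemma eberlein_smulian C u : weakly_compact C -> (forall n, C (u n)) ->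
  exists (phi : nat -> nat) x,
    [/\ {homo phi : m n / (m < n)%N}, C x & weakly_cvg (u \o phi) x].
Proof.
move=> wC Cu; have [x Cx xu] := weakly_compact_cluster _ _ wC Cu.
(* Numbers that encode no list get the value 0. *)
pose D j := oapp (rat_comb u) 0 (unpickle j).
(* The F j separate the points of the closed span, so all weak cluster points of a
   subsequence along which every F j converges coincide. *)
have /choice[F FP] := fun j => norming_functional (D j).
have dF j : dual_functional (F j) by case: (FP j).
(* Stage [k] controls the first [k + 1] functionals up to [1 / (k + 1)], so each [F j] converges
   along [phi]. *)
have [k N|phi phiI phiP] := increasing_selection
    (fun k n => forall j, (j <= k)%N -> `|F j (u n) - F j x| < k.+1%:R^-1).
  have [|g|n Nn nP] := xu [seq F j | j <- iota 0 k.+1] k.+1%:R^-1 N.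
  - by rewrite invr_gt0.
  - by move=> /mapP[j _ ->].
  - by exists n => // j jk; apply: nP; apply: map_f; rewrite mem_iota.
exists phi, x; split=> // f df; apply: contrapT => ncvg.
have [e e0 fe] : exists2 e : R, 0 < e &
    forall N, exists2 n, (N <= n)%N & e <= `|f (u (phi n)) - f x|.
  apply: contrapT => ne; apply: ncvg; apply/cvgrPdist_lt => e e0.
  apply: contrapT => nN; apply: ne; exists e => // N.
  apply: contrapT => nn; apply: nN; exists N => // n /= Nn.
  by rewrite distrC ltNge; apply/negP => en; apply: nn; exists n.
have [psi psiI psiP] := increasing_selection
  (fun _ n => e <= `|f (u (phi n)) - f x|) (fun _ => fe).
(* Along [psi] the values of [f] stay [e] away from [f x], so a cluster point [x'] of this
   subsequence differs from [x]. *)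
have [x' Cx' xu'] := weakly_compact_cluster C (u \o (phi \o psi)) wC (fun n => Cu _).
have xx' : x - x' != 0.
  apply/negP => /eqP/subr0_eq xx'.
  have [|n _] := xu' [:: f] e 0%N e0; first by move=> g; rewrite inE => /eqP ->.
  by move=> /(_ f (mem_head _ _)) /=; rewrite -xx' ltNge psiP.
have Y : rat_span_closure u (x - x').
  rewrite -scaleN1r addrC; apply: rat_span_closure_lin.
    exact: weak_cluster_rat_span_closure xu'.
  exact: (weak_cluster_rat_span_closure _ id).
have FE j : F j x = F j x'.
  apply/eqP; rewrite -subr_eq0 -normr_le0; apply/ler_addgt0Pr => d d0; rewrite add0r.
  have d2 : 0 < d / 2 by rewrite divr_gt0.
  have [|n nN] := xu' [:: F j] (d / 2) (maxn j (Num.truncn (d / 2)^-1).+1) d2.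
    by move=> g; rewrite inE => /eqP ->.
  move=> /(_ (F j) (mem_head _ _)) /= Fx'.
  have psin : (n <= psi n)%N by exact: increasing_ge_id.
  move: nN; rewrite geq_max => /andP[jn dn].
  have Fx : `|F j (u (phi (psi n))) - F j x| < d / 2.
    apply: lt_trans (phiP (psi n) j (leq_trans jn psin)) _.
    rewrite invf_plt ?posrE//; apply: lt_le_trans (truncnS_gt _) _.
    by rewrite ler_nat (leq_trans dn)// (leq_trans psin).
  have := ler_distD (F j (u (phi (psi n)))) (F j x) (F j x').
  rewrite [`|F j x - F j (u _)|]distrC; lra.
(* Let [d] be the combination found within [|x - x'| / 4] of [x - x']. Its norming functional
   vanishes at [x - x'], so [|d| <= |x - x'| / 4], whereas [|d| >= 3 / 4 * |x - x'|]. *)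
have [|s sP] := Y (`|x - x'| / 4); first by rewrite divr_gt0 ?normr_gt0.
have [_ Fle FD] := FP (pickle s).
have := dual_le_normr _ (dF _) Fle (x - x' - rat_comb u s).
have <- : D (pickle s) = rat_comb u s by rewrite /D pickleK.
rewrite dualB// dualB// FE subrr sub0r normrN FD normr_id.
have := lerB_dist (x - x') (D (pickle s)).
move: xx' sP; rewrite -normr_gt0 /D pickleK/=; lra.
Qed.

End EberleinSmulian.

(** * Norm boundedness of weakly compact sets, by a gliding hump *)

Section Boundedness.
Context {R : realType} {X : normedModType R}.
Implicit Types (f : X -> R) (x y z : X) (C : set X).

(* The signs make |hump g u n.+1 (u n)| >= 3^-n |g n (u n)|, while the later terms
   add up to at most half of this when g n (u n) = |u n|. *)
Fixpoint hump (g : nat -> X -> R) (u : nat -> X) (n : nat) : X -> R :=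
  if n is n'.+1 then
    fun x => hump g u n' x +
      (if 0 <= hump g u n' (u n') then 1 else -1) * (3^-1 ^+ n' * g n' x)
  else fun=> 0.

Section Hump.
Variables (g : nat -> X -> R) (u : nat -> X).
Hypothesis g_dual : forall n, dual_functional (g n).
Hypothesis g_le : forall n x, g n x <= `|x|.
Hypothesis g_norming : forall n, g n (u n) = `|u n|.
Local Notation h := (hump g u).

Lemma hump_linear n a x y : h n (a *: x + y) = a * h n x + h n y.
Proof.
elim: n => [|n IH] /=; first by rewrite mulr0 addr0.
by rewrite IH (g_dual n).1; ring.
Qed.

Lemma hump_ge n : 3^-1 ^+ n * `|u n| <= `|h n.+1 (u n)|.
Proof.
rewrite /= g_norming; have : 0 <= 3^-1 ^+ n * `|u n| by rewrite mulr_ge0// exprn_ge0.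
set b := 3^-1 ^+ n * `|u n|.
case: (leP 0 (h n (u n))) => hn b0; rewrite ler_normr; apply/orP; [left|right]; lra.
Qed.

(** The constant is the geometric sum of [3^-1 ^+ i] over [n <= i < n + k]. *)
Lemma hump_dist n k x :
  `|h (n + k)%N x - h n x| <= 3 / 2 * (3^-1 ^+ n - 3^-1 ^+ (n + k)) * `|x|.
Proof.
elim: k => [|k IH]; first by rewrite addn0 !subrr normr0 mulr0 mul0r.
rewrite addnS /= exprS; set s := (X in X * _); set m := (n + k)%N in IH *.
apply: le_trans (ler_distD (h m x) _ _) _; rewrite addrAC subrr add0r.
have -> : `|s * (3^-1 ^+ m * g m x)| = 3^-1 ^+ m * `|g m x|.
  by rewrite normrM {1}/s; case: ifP => _; rewrite ?normrN normr1 mul1r normrM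
    (ger0_norm (exprn_ge0 _ _)).
have : 3^-1 ^+ m * `|g m x| <= 3^-1 ^+ m * `|x|.
  by rewrite ler_wpM2l ?exprn_ge0//; exact: dual_le_normr.
by move: IH; lra.
Qed.

(** The functionals converge pointwise. The tail after stage [n.+1] is at most
    [3 / 2 * 3^-1 ^+ n.+1 = 3^-1 ^+ n / 2] times the norm, half of what [hump_ge] provides. *)
Lemma ex_hump_limit : exists f, dual_functional f /\
  forall n, `|f (u n)| >= 3^-1 ^+ n / 2 * `|u n|.
Proof.
have h_le m n x : (n <= m)%N -> `|h m x - h n x| <= 3 / 2 * 3^-1 ^+ n * `|x|.
  move=> nm; have := hump_dist n (m - n) x; rewrite subnKC// => /le_trans; apply.
  by rewrite ler_wpM2r// ler_wpM2l// gerBl exprn_ge0.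
have hcvg x : cvgn (fun n => h n x).
  apply/cauchy_cvgP/cauchy_exP => e e0.
  have [n nP] : exists n, 3 / 2 * 3^-1 ^+ n * `|x| < e.
    have /cvgrPdist_lt/(_ e e0) : (fun n => 3 / 2 * `|x| * 3^-1 ^+ n) @ \oo --> (0 : R).
      rewrite -[X in _ --> X](mulr0 (3 / 2 * `|x|)); apply: cvgMr.
      by apply: cvg_expr; rewrite ger0_norm ?invr_ge0// invf_lt1// ltr1n.
    move=> [N _ /(_ N (leqnn N)) /=]; rewrite sub0r normrN => NP; exists N.
    by apply: le_lt_trans NP; rewrite mulrAC ler_norm.
  exists (h n x), n => // m /= nm.
  by rewrite /ball/= distrC (le_lt_trans (h_le _ _ _ nm)).
pose f x := limn (fun n => h n x).
have f_dist n x : `|f x - h n x| <= 3 / 2 * 3^-1 ^+ n * `|x|.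
  have c : (fun m => `|h m x - h n x|) @ \oo --> `|f x - h n x|.
    by apply: cvg_norm; apply: cvgB; [exact: hcvg | exact: cvg_cst].
  by rewrite -(cvg_lim _ c)//; apply: limr_le; [apply/cvg_ex; eexists; exact: c |
    exists n => // m /= nm; exact: h_le].
exists f; split.
  apply: (linear_bounded_dual _ (3 / 2)).
    move=> a x y; apply: cvg_lim => //.
    under eq_fun do rewrite hump_linear.
    by apply: cvgD; [apply: cvgMr|]; exact: hcvg.
  move=> x; have := f_dist 0%N x; rewrite /= subr0 expr0 mulr1.
  exact: le_trans (ler_norm _).
move=> n; have := hump_ge n; have := f_dist n.+1 (u n); rewrite exprS.
by have := lerB_dist (h n.+1 (u n)) (f (u n)); rewrite [`|f _ - _|]distrC; lra.
Qed.

End Hump.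

(** Points with [|u n| > 2 * n * 3 ^+ n] would make the hump functional exceed [n] at [u n], yet
    each single functional is bounded on [C]. *)
Lemma weakly_compact_bounded C : weakly_compact C ->
  exists B : R, forall x, C x -> `|x| <= B.
Proof.
move=> wC; apply: contrapT => nB.
have /choice[u uP] : forall n : nat, exists x, C x /\ 2 * n%:R * 3 ^+ n < `|x|.
  move=> n; apply: contrapT => nx; apply: nB; exists (2 * n%:R * 3 ^+ n) => x Cx.
  by rewrite leNgt; apply/negP => xn; apply: nx; exists x.
have /choice[g gP] := fun n => norming_functional (u n).
have [f [df fu]] := ex_hump_limit g u (fun n => let: And3 d _ _ := gP n in d)
  (fun n => let: And3 _ d _ := gP n in d) (fun n => let: And3 _ _ d := gP n in d).
have [B fB] := dual_bounded_on _ _ wC df.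
pose n := (Num.truncn B).+1.
have := fB _ (uP n).1; rewrite leNgt => /negP; apply.
apply: lt_le_trans (fu n); apply: lt_trans (truncnS_gt _) _.
rewrite -/n mulrAC exprVn ltr_pdivlMr// ltr_pdivlMl ?exprn_gt0//.
by have := (uP n).2; lra.
Qed.

End Boundedness.

(** * Ramsey's theorem for two colours *)

Section Ramsey.

Definition unbounded (M : set nat) := forall N, exists2 n, (N <= n)%N & M n.

(** Fusion: pick a new element [a k] of the current set, then shrink that set to [Ms k] so that [Q]
    holds. All later elements come from [Ms k]. Both Ramsey's theorem and the diagonal sequence
    against the weak Banach-Saks property are built this way. *)
Lemma diagonal_chain (Q : nat -> nat -> set nat -> Prop) (M : set nat) :
  (forall k a M', unbounded M' ->
    exists N, [/\ unbounded N, N `<=` M' & Q k a N]) ->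
  unbounded M -> exists (a : nat -> nat) (Ms : nat -> set nat),
  [/\ {homo a : m n / (m < n)%N}, forall k, M (a k), forall k, Q k (a k) (Ms k) &
      forall j k, (k < j)%N -> Ms k (a j)].
Proof.
move=> QH Minf.
(* Choice needs total functions, so bounded sets receive dummy values; [st k] below pairs the
   element last chosen with the set that remains. *)
have /choice[G GP] : forall s : nat * nat * set nat, exists N, unbounded s.2 ->
    [/\ unbounded N, N `<=` s.2 & Q s.1.1 s.1.2 N].
  move=> [[k a] M']; have [M'inf|M'fin] := pselect (unbounded M').
    by have [N] := QH k a _ M'inf; exists N.
  by exists set0.
have /choice[e eP] : forall s : nat * set nat, exists n, unbounded s.2 ->
    (s.1 <= n)%N /\ s.2 n.
  move=> [N M']; have [M'inf|M'fin] := pselect (unbounded M').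
    by have [n] := M'inf N; exists n.
  by exists 0%N.
pose st := fix st k : nat * set nat :=
  if k is k'.+1 then let a := e ((st k').1.+1, (st k').2) in (a, G (k, a, (st k').2))
  else let a := e (0, M)%N in (a, G (0, a, M)%N).
have stinf k : unbounded (st k).2.
  elim: k => [|k IH] /=; first by case: (GP (0, e (0, M), M)%N).
  by case: (GP (k.+1, e ((st k).1.+1, (st k).2), (st k).2)).
have stS k : [/\ (st k).2 (st k.+1).1, (st k.+1).2 `<=` (st k).2,
    ((st k).1 < (st k.+1).1)%N & Q k.+1 (st k.+1).1 (st k.+1).2].
  have [? ?] := eP ((st k).1.+1, (st k).2) (stinf k).
  by have [] := GP (k.+1, e ((st k).1.+1, (st k).2), (st k).2) (stinf k).
have [st0inf st0M st0Q] := GP (0, e (0, M), M)%N Minf.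
have stsub j k : (k <= j)%N -> (st j).2 `<=` (st k).2.
  elim: j => [|j IH]; first by rewrite leqn0 => /eqP ->.
  rewrite leq_eqVlt ltnS => /predU1P[->//|/IH]; apply: subset_trans.
  by case: (stS j).
exists (fun k => (st k).1), (fun k => (st k).2); split.
- by apply: homo_ltn => [? ? ?|k]; [exact: ltn_trans | case: (stS k)].
- case=> [|k]; first by case: (eP (0, M)%N Minf).
  by apply: st0M; apply: (stsub k 0%N) => //; case: (stS k).
- by case=> [|k] //; case: (stS k).
- by case=> // j k; rewrite ltnS => kj; apply: (stsub j) => //; case: (stS j).
Qed.

(** An [m]-element subset is represented by its increasing enumeration; [P] is the two-colouring and
    [b] the common colour. *)
Definition homogeneous (m : nat) (P : seq nat -> Prop) (N : set nat) (b : bool) :=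
  forall s, sorted ltn s -> size s = m -> (forall x, x \in s -> N x) -> (P s <-> b).

(** Induction on [m]: along the diagonal sequence the colour of a set depends only on its least
    element [a k], and is [c k]. *)
Lemma ramsey m (P : seq nat -> Prop) (M : set nat) : unbounded M ->
  exists N b, [/\ unbounded N, N `<=` M & homogeneous m P N b].
Proof.
elim: m P M => [|m IH] P M Minf.
  exists M, `[< P [::] >]; split=> // s _ /size0nil -> _.
  by split=> /asboolP.
have [||a [Ms [aI aM aQ aMs]]] := diagonal_chain
    (fun _ a N => exists b, homogeneous m (fun s => P (a :: s)) N b) M.
- by move=> _ a M' /(IH (fun s => P (a :: s)))[N [b [? ? ?]]]; exists N; split=> //; exists b.
- exact: Minf.
have /choice[c cP] := aQ.
(* Pigeonhole: one colour occurs for arbitrarily large [k], and the elements of that colour form the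
   homogeneous set. *)
have [b bP] : exists b, forall K, exists2 k, (K <= k)%N & c k = b.
  have [tP|] := pselect (forall K, exists2 k, (K <= k)%N & c k = true).
    by exists true.
  move=> /existsNP[K KP]; exists false => K'.
  exists (maxn K K'); first exact: leq_maxr.
  by apply: contra_notF KP => ck; exists (maxn K K'); first exact: leq_maxl.
exists [set n | exists2 k, n = a k & c k = b], b; split.
- move=> N; have [k Nk ck] := bP N; exists (a k); last by exists k.
  exact: leq_trans Nk (increasing_ge_id _ aI k).
- by move=> _ [k -> _].
case=> // x s xs [ss] sN; have [k xk ck] := sN x (mem_head _ _).
rewrite {}xk in xs *; rewrite -ck; apply: cP => //; first exact: path_sorted xs.
move=> y ys; have [|j yj _] := sN y; first by rewrite inE ys orbT.
rewrite yj; apply: aMs; rewrite -(leqW_mono (leq_mono aI)) -yj.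
by move/(order_path_min ltn_trans)/allP : xs; exact.
Qed.

End Ramsey.

(** * Uniformly small sums from the weak Banach-Saks property *)

Section UniformCesaro.
Context {R : realType} {X : normedModType R}.
Implicit Types (x y z : X) (C : set X) (u : nat -> X).

Lemma cesaro_sum_norm u x n :
  `|\sum_(0 <= i < n.+1) (u i - x)| =
  n.+1%:R * `|x - n.+1%:R^-1 *: \sum_(i < n.+1) u i|.
Proof.
rewrite big_mkord sumrB sumr_const card_ord -scaler_nat.
rewrite -{1}[\sum_(i < n.+1) u i](scalerKV (_ : n.+1%:R != 0 :> R)) ?pnatr_eq0//.
by rewrite -scalerBr normrZ distrC ger0_norm.
Qed.

Lemma ex_homogeneous_small_sums C u x (e : R) : weak_banach_saks C ->
  (forall n, C (u n)) -> weakly_cvg u x -> 0 < e ->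
  exists m N, [/\ (0 < m)%N, unbounded N & forall s, sorted ltn s -> size s = m ->
    (forall k, k \in s -> N k) -> `|\sum_(k <- s) (u k - x)| <= e * m%:R].
Proof.
move=> wbs Cu ux e0; apply: contrapT => nex.
have [||a [Ms [aI _ aQ aMs]]] := diagonal_chain (fun k _ N => homogeneous k.+1
    (fun s => `|\sum_(k <- s) (u k - x)| <= e * k.+1%:R) N false) setT.
- move=> k _ M /(ramsey k.+1 (fun s => `|\sum_(k <- s) (u k - x)| <= e * k.+1%:R)).
  move=> [N [[] [Ninf NM NP]]]; last by exists N.
  (* The colour [true] would give the desired set at once, so only [false] remains for every
     length. *)
  by exfalso; apply: nex; exists k.+1, N; split=> // s ss sm /(NP s ss sm)[_]; exact.
- by move=> N; exists N.
have [|phi [phiI /cvgrPdist_lt/(_ (e / 4))[|N _ avgN]]] := wbs (u \o a) x (fun n => Cu _).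
- move=> f df; apply: (cvg_comp _ _ _ (ux f df)) => A [K _ KA]; exists K => // n /= Kn.
  by apply: KA; exact: leq_trans Kn (increasing_ge_id _ aI n).
- by rewrite divr_gt0.
pose v i := u (a (phi i)); pose m := N.+1.
have sumv n : (N <= n)%N -> `|\sum_(0 <= i < n.+1) (v i - x)| <= n.+1%:R * (e / 4).
  by move=> Nn; rewrite cesaro_sum_norm ler_wpM2l// ltW//; exact: avgN.
(* The block of [m = N + 1] terms from index [m] on lies in [Ms N], so its sum should exceed
   [e * m]. As a difference of partial sums of lengths [2 m] and [m], it is at most
   [3 / 4 * e * m]. *)
pose s := [seq a (phi i) | i <- index_iota m (m + m)].
have aphiI : {homo a \o phi : i j / (i < j)%N} by move=> i j ij; exact/aI/phiI.
have s_sorted : sorted ltn s.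
  by rewrite /s sorted_map; apply: sub_sorted (iota_ltn_sorted _ _) => i j; exact: aphiI.
have s_size : size s = m by rewrite size_map size_iota addKn.
have [|large _] := aQ N s s_sorted s_size.
  move=> k /mapP[i]; rewrite mem_index_iota => /andP[mi _] ->; apply: aMs.
  exact: leq_trans mi (increasing_ge_id _ phiI i).
suff /large : `|\sum_(k <- s) (u k - x)| <= e * m%:R by [].
rewrite /s big_map.
have := sumv N (leqnn N); have := sumv (N + m)%N (leq_addr _ _).
rewrite -addSn -/m (big_cat_nat (n := m)) ?leq_addr//=.
set S1 := \sum_(0 <= i < m) _; set S2 := \sum_(m <= i < m + m) _.
have := ler_normB (S1 + S2) S1; rewrite addrAC subrr add0r natrD.
by have := mulr_ge0 (ltW e0) (ler0n R m); lra.
Qed.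

(** Induction on the length removes blocks of [m] terms, each costing [e * m]; the fewer than [m]
    remaining terms cost at most [D] each. *)
Lemma small_block_sums u x (e D : R) m : (0 < m)%N -> 0 <= e ->
  (forall k, `|u k - x| <= D) ->
  (forall s, sorted ltn s -> size s = m -> `|\sum_(k <- s) (u k - x)| <= e * m%:R) ->
  forall s, sorted ltn s -> `|\sum_(k <- s) (u k - x)| <= e * (size s)%:R + m%:R * D.
Proof.
move=> m0 e0 uD um s; have D0 : 0 <= D by exact: le_trans (uD 0%N).
have [n] := ubnP (size s); elim: n s => // n IH s; rewrite ltnS => sn ss.
have [ms|sm] := leqP m (size s).
  rewrite -{1}(cat_take_drop m s) big_cat/=.
  have := um _ (take_sorted m ss) (size_takel ms).
  have := IH (drop m s); rewrite size_drop (leq_trans _ sn); last by rewrite ltn_subrL m0 (leq_trans m0).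
  move=> /(_ isT (drop_sorted m ss)); rewrite natrB//.
  have := ler_normD (\sum_(k <- take m s) (u k - x)) (\sum_(k <- drop m s) (u k - x)).
  lra.
apply: (@le_trans _ _ ((size s)%:R * D)).
  apply: le_trans (ler_norm_sum _ _ _) _.
  apply: (@le_trans _ _ (\sum_(k <- s) D)); first exact: ler_sum.
  by rewrite big_const_seq count_predT iter_addr_0 mulr_natl.
have : (size s)%:R * D <= m%:R * D by rewrite ler_wpM2r// ler_nat ltnW.
by have := mulr_ge0 e0 (ler0n R (size s)); lra.
Qed.

Lemma cm_sup_le n u x i (B : R) : 0 <= B ->
  (forall s, sorted ltn s -> (size s <= n)%N -> `|\sum_(k <- s) (u k - x)| <= B) ->
  cm_sup n u x i <= B.
Proof.
move=> B0 sB; apply: bigmax_le => // A _.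
(* Enumerating [A] and shifting by [i] gives a strictly increasing list of indices, to which [sB]
   applies. *)
rewrite -big_enum/= -(big_map (fun k : 'I_n => (i + k.+1)%N) xpredT (fun k => u k - x)).
apply: sB; last by rewrite size_map -cardE -[X in (_ <= X)%N](card_ord n) max_card.
have -> : [seq (i + k.+1)%N | k : 'I_n <- enum A] =
    [seq (i + k.+1)%N | k <- map val (enum A)].
  by rewrite -map_comp.
rewrite sorted_map; apply: (@sub_sorted _ ltn) => [j k jk|]; first by rewrite /= ltn_add2l ltnS.
rewrite sorted_map; apply: sorted_filter => [? ? ?|]; first exact: ltn_trans.
by rewrite -enumT -sorted_map val_enum_ord iota_ltn_sorted.
Qed.

Lemma cm_sup_ge n u x i : `|\sum_(k < n) (u (i + k.+1)%N - x)| <= cm_sup n u x i.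
Proof.
have -> : \sum_(k < n) (u (i + k.+1)%N - x) = \sum_(k in finset (@predT 'I_n)) (u (i + k.+1)%N - x).
  by apply: eq_bigl => k; rewrite finset.in_set.
exact: (le_bigmax _ (fun A : {set 'I_n} => `|\sum_(k in A) (u (i + k.+1)%N - x)|)).
Qed.

End UniformCesaro.

(** * Constant bounds on upper limits *)

Section Limsup.
Context {R : realType}.
Implicit Types (u : (\bar R)^nat) (c : \bar R).

Lemma limn_esup_le_ub u c : (forall i, (u i <= c)%E) -> (limn_esup u <= c)%E.
Proof.
move=> uc; rewrite limn_esup_lim; apply: lime_le; first exact: is_cvg_esups.
by apply: nearW => n; apply: ge_ereal_sup => _ [i _ <-].
Qed.

Lemma limn_esup_ge_lb u c N : (forall i, (N <= i)%N -> (c <= u i)%E) -> (c <= limn_esup u)%E.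
Proof.
move=> cu; rewrite limn_esup_lim; apply: lime_ge; first exact: is_cvg_esups.
apply: nearW => n; apply: le_trans (cu (maxn n N) (leq_maxr _ _)) _.
by apply: ereal_sup_ubound; exists (maxn n N) => //=; exact: leq_maxl.
Qed.

End Limsup.

(** * Approximate fixed points of nonexpansive maps *)

Lemma approximate_fixed_point {R : realType} {X : normedModType R} (C : set X)
    (T : X -> X) (B e : R) : C !=set0 -> convex_set_X C ->
  (forall x, C x -> C (T x)) -> nonexpansive_on C T ->
  (forall x, C x -> `|x| <= B) -> 0 < e ->
  exists2 z, C z & `|T z - z| < e.
Proof.
move=> [x0 Cx0] cC CT Tne CB e0.
have B0 : 0 <= B by exact: le_trans (CB _ Cx0).
have diam x y : C x -> C y -> `|x - y| <= 2 * B.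
  by move=> Cx Cy; have := CB _ Cx; have := CB _ Cy; have := ler_normB x y; lra.
(* This choice gives [t * (2 * B) <= e / 2]; the term [2 * e] keeps the denominator positive and
   [t < 1] even when [B = 0]. *)
pose t : R := e / (2 * e + 4 * B).
have d0 : 0 < 2 * e + 4 * B by lra.
have t0 : 0 < t by rewrite divr_gt0.
have t1 : t < 1 by rewrite ltr_pdivrMr//; lra.
have t1' : 0 <= 1 - t by rewrite subr_ge0 ltW.
have tB : t * (2 * B) <= e / 2.
  by rewrite mulrAC ler_pdivrMr//; have := sqr_ge0 e; nra.
pose S z := t *: x0 + (1 - t) *: T z.
have CS z : C z -> C (S z) by move=> Cz; apply: cC => //; [exact: CT | exact: ltW | exact: ltW].
pose z n := iter n S x0.
have Cz n : C (z n) by elim: n => //= n IH; exact: CS.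
(* [S] contracts by [1 - t], so successive iterates get arbitrarily close; a late iterate serves in
   place of a fixed point of [S]. *)
have zS n : `|z n.+1 - z n| <= (1 - t) ^+ n * (2 * B).
  elim: n => [|n IH]; first by rewrite mul1r; exact: diam (Cz 1%N) (Cz 0%N).
  rewrite exprS -mulrA.
  have -> : z n.+2 - z n.+1 = (1 - t) *: (T (z n.+1) - T (z n)).
    by rewrite /z /= -/(z n) {1 3}/S opprD addrACA subrr add0r scalerBr.
  rewrite normrZ ger0_norm// ler_wpM2l//.
  exact: le_trans (Tne _ _ (Cz _) (Cz _)) IH.
have [n zn] : exists n, (1 - t) ^+ n * (2 * B) < e / 2.
  have /cvgrPdist_lt/(_ (e / 2)) : (fun n => 2 * B * (1 - t) ^+ n) @ \oo --> (0 : R).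
    rewrite -[X in _ --> X](mulr0 (2 * B)); apply: cvgMr; apply: cvg_expr.
    by rewrite ger0_norm; lra.
  move=> [|N _ /(_ N (leqnn N)) /=]; first by rewrite divr_gt0.
  rewrite sub0r normrN => NP; exists N.
  by apply: le_lt_trans NP; rewrite mulrC ler_norm.
exists (z n) => //.
have ST : T (z n) - z n.+1 = t *: (T (z n) - x0).
  by rewrite -[z n.+1]/(S (z n)) /S scalerBl scale1r scalerBr opprD opprB addrCA subrKC addrC.
have := ler_distD (z n.+1) (T (z n)) (z n); rewrite ST normrZ (ger0_norm (ltW t0)).
have : t * `|T (z n) - x0| <= t * (2 * B) by rewrite ler_wpM2l ?(ltW t0)// diam//; exact: CT.
by have := zS n; lra.
Qed.

(** * Existence of a fixed point *)

Theorem theorem4p4 (R : realType) (X : completeNormedModType R) (C : set X) :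
  C !=set0 -> weakly_compact C -> convex_set_X C -> weak_banach_saks C ->
  forall T : X -> X, cm_nonexpansive C T ->
  exists2 x, C x & T x = x.
Proof.
move=> C0 wC cC wbs T [CT Tne Tcm].
have [B CB] := weakly_compact_bounded _ wC.
have /choice[v vP] : forall n : nat, exists z, C z /\ `|T z - z| < n.+1%:R^-1.
  move=> n; have [|z] := approximate_fixed_point C T B n.+1%:R^-1 C0 cC CT Tne CB.
    by rewrite invr_gt0.
  by exists z.
have [phi [x [phiI Cx vx]]] := eberlein_smulian _ _ wC (fun n => (vP n).1).
exists x => //; apply: contrapT => Txx.
have {}Txx : 0 < `|x - T x| by rewrite normr_gt0 subr_eq0; apply/eqP => /esym.
(* The factor 4 beats the bound [|x - T x| <= 2 * e] reached in the limit. *)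
pose e := `|x - T x| / 4; have e0 : 0 < e by rewrite divr_gt0.
have [m [N [m0 Ninf Nsum]]] :=
  ex_homogeneous_small_sums _ _ _ _ wbs (fun n => (vP (phi n)).1) vx e0.
have [psi psiI psiN] := increasing_selection (fun _ n => N n) (fun _ => Ninf).
pose w k := v (phi (psi k)).
have Cw k : C (w k) by exact: (vP _).1.
have Tw k : `|T (w k) - w k| < k.+1%:R^-1.
  apply: lt_le_trans (vP _).2 _; rewrite lef_pV2 ?posrE// ler_nat ltnS.
  exact: leq_trans (increasing_ge_id _ psiI k) (increasing_ge_id _ phiI _).
have wD k : `|w k - x| <= 2 * B.
  by have := CB _ (Cw k); have := CB _ Cx; have := ler_normB (w k) x; lra.
have wsum := small_block_sums w x e (2 * B) m m0 (ltW e0) wD.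
have {}wsum : forall s, sorted ltn s ->
    `|\sum_(k <- s) (w k - x)| <= e * (size s)%:R + m%:R * (2 * B).
  apply: wsum => s ss sm; have := Nsum (map psi s); rewrite size_map big_map; apply=> //.
    by rewrite sorted_map; apply: sub_sorted ss => i j; exact: psiI.
  by move=> _ /mapP[i _ ->].
have B0 : 0 <= B by exact: le_trans (CB _ Cx).
pose bound n : R := e * n%:R + m%:R * (2 * B).
have bound_ge0 n : 0 <= bound n.
  by rewrite addr_ge0// mulr_ge0// ?(ltW e0)// mulr_ge0.
have upper n i : cm_sup n w x i <= bound n.
  apply: cm_sup_le => // s ss sn; apply: le_trans (wsum s ss) _.
  by rewrite lerD2r ler_wpM2l ?(ltW e0)// ler_nat.
(* For [i >= n] all indices involved exceed [n], so the [n] errors [T (w k) - w k] are below [1 / n]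
   each and add up to at most 1. *)
have lower n i : (n <= i)%N ->
    n%:R * `|x - T x| - bound n - 1 <= cm_sup n (T \o w) (T x) i.
  move=> ni; apply: le_trans _ (cm_sup_ge _ _ _ _).
  have := le_trans (cm_sup_ge n w x i) (upper n i).
  set S := \sum_(k < n) (w _ - x); set S' := \sum_(k < n) (_ - T x) => SB.
  have E : n%:R *: (x - T x) = S' - S - \sum_(k < n) (T (w (i + k.+1)%N) - w (i + k.+1)%N).
    rewrite -!sumrB -[LHS]/(_ *: _) scaler_nat -[n in LHS]card_ord -sumr_const.
    apply: eq_bigr => k _ /=; set p := T (w _); set q := w _.
    by rewrite !opprB !addrA subrK -(addrA p) [_ - p]addrC addKr addrC.
  have : `|\sum_(k < n) (T (w (i + k.+1)%N) - w (i + k.+1)%N)| <= 1.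
    apply: le_trans (ler_norm_sum _ _ _) _.
    have [n0|n0] := posnP n; first by rewrite n0 big_ord0.
    apply: (@le_trans _ _ (\sum_(k < n) n%:R^-1)).
      apply: ler_sum => k _; apply: ltW; apply: lt_le_trans (Tw _) _.
      by rewrite lef_pV2 ?posrE ?ltr0n// ler_nat (leq_trans ni)// leqW// leq_addr.
    by rewrite sumr_const card_ord -(mulr_natr n%:R^-1) mulVf// pnatr_eq0 -lt0n.
  have := ler_normB (S' - S) (\sum_(k < n) (T (w (i + k.+1)%N) - w (i + k.+1)%N)).
  rewrite -E normrZ ger0_norm//.
  by have := ler_normB S' S; lra.
have main n : n%:R * `|x - T x| - bound n - 1 <= bound n.
  rewrite -lee_fin; apply: (@le_trans _ _ (limn_esup (fun i => (cm_sup n (T \o w) (T x) i)%:E))).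
    by apply: (limn_esup_ge_lb _ _ n) => i ni; rewrite lee_fin lower.
  apply: le_trans (Tcm n x w Cx Cw) _.
  by apply: limn_esup_le_ub => i; rewrite lee_fin upper.
(* With [|x - T x| = 4 * e], [main n] reads [2 * e * n <= b], which fails once [n > b / (2 * e)]. *)
pose b := 2 * (m%:R * (2 * B)) + 1.
pose n := (Num.truncn (b / (2 * e))).+1.
have : b / (2 * e) < n%:R by exact: truncnS_gt.
rewrite ltr_pdivrMr ?mulr_gt0//; have := main n; rewrite /bound /b.
have -> : `|x - T x| = 4 * e by rewrite /e; lra.
lra.
Qed.
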